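(* Let $A,B$ be commutative rings, $f:A\to B$ a ring homomorphism and $J$ an ideal of $B$ with $J\subseteq\operatorname{Nil}(B)$, regarded as an $A$-module via $f$. Then the ring $A\bowtie^fJ$ is Cohen–Macaulay in the sense of ideals if and only if $A$ is Cohen–Macaulay in the sense of ideals and $\operatorname{Kgrade}_A(\mathfrak a,J)\ge\operatorname{ht}\mathfrak a$ for every ideal $\mathfrak a$ of $A$.
   Context: $\operatorname{Nil}(B)$ is the nilradical. $A\bowtie^fJ=\{(a,f(a)+j): a\in A,\ j\in J\}\subseteq A\times B$. Koszul grade: for a ring $R$, an $R$-module $M$ and a finitely generated ideal $\mathfrak b=(x_1,\dots,x_\ell)$, $\operatorname{Kgrade}_R(\mathfrak b,M)=\inf\{i\ge0: H^i(\operatorname{Hom}_R(\mathbb K_\bullet(x_1,\dots,x_\ell),M))\ne0\}$ ($\inf\emptyset=\infty$), independent of generators; for arbitrary $\mathfrak a$, the sup over finitely generated subideals. $\operatorname{ht}I=\inf\{\dim R_\mathfrak P:\mathfrak P\supseteq I$ prime$\}$. A ring $R$ is Cohen–Macaulay in the sense of ideals if $\operatorname{ht}I=\operatorname{Kgrade}_R(I,R)$ for every ideal $I$ of $R$. *)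

(* Defs.v *)
From HB Require Import structures.
From mathcomp Require Import all_boot all_order all_algebra.
Set Implicit Arguments. Unset Strict Implicit. Unset Printing Implicit Defensive.
Import Order.TTheory GRing.Theory.
Local Open Scope ring_scope.

(* A ring is given as a carrier predicate [S] on a commutative ring [R]
   (a subring, with the induced operations).  For a ring [A] itself we use
   [S := fun _ => True]; for [A ⋈^f J] we use R := A * B and S := bowtie f J. *)

Section Defs.
Variable R : comNzRingType.
Variable S : R -> Prop.

Definition is_ideal (I : R -> Prop) : Prop :=
  (forall x, I x -> S x) /\ I 0 /\
  (forall x y, I x -> I y -> I (x + y)) /\
  (forall x, I x -> I (- x)) /\
  (forall s x, S s -> I x -> I (s * x)).

Definition is_prime (P : R -> Prop) : Prop :=
  is_ideal P /\ ~ P 1 /\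
  (forall a b, S a -> S b -> P (a * b) -> P a \/ P b).

Definition strict_incl (P Q : R -> Prop) : Prop :=
  (forall x, P x -> Q x) /\ exists x, Q x /\ ~ P x.

Definition prime_chain_below (P : R -> Prop) (n : nat) : Prop :=
  exists C : nat -> R -> Prop,
    (forall k, k <= n -> is_prime (C k))%N /\
    (forall k, k < n -> strict_incl (C k) (C k.+1))%N /\
    C n = P.

(* dim S_P >= n  (primes of the localization S_P correspond to primes of S
   contained in P, so this is: a chain of primes of length n ending at P). *)
Definition dim_loc_ge (P : R -> Prop) (n : nat) : Prop := prime_chain_below P n.

(* ht I >= n  (ht I = inf over primes P ⊇ I of dim S_P, inf ∅ = ∞) *)
Definition ht_ge (I : R -> Prop) (n : nat) : Prop :=
  forall P, is_prime P -> (forall x, I x -> P x) -> dim_loc_ge P n.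

(* ---------- Koszul cohomology H^i(Hom(K_•(x_1..x_l), M)) ----------
   M is a module over S given as a predicate [M] on a zmodType [V] with
   scalar action [act].  The i-th cochain group Hom(K_i, M) is M^(l choose i),
   indexed by the i-subsets T of {0..l-1}. *)
Variable V : zmodType.
Variable act : R -> V -> V.
Variable M : V -> Prop.

Definition kd (l : nat) (x : 'I_l -> R) (c : {set 'I_l} -> V) (T : {set 'I_l}) : V :=
  \sum_(j in T)
     (if odd #|[set k in T | (k < j)%N]| then - act (x j) (c (T :\ j))
      else act (x j) (c (T :\ j))).

Definition koszul_H_nonzero (l : nat) (x : 'I_l -> R) (i : nat) : Prop :=
  exists c : {set 'I_l} -> V,
    (forall T : {set 'I_l}, #|T| = i -> M (c T)) /\
    (forall T : {set 'I_l}, #|T| <> i -> c T = 0) /\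
    (forall T : {set 'I_l}, kd x c T = 0) /\
    ~ (exists b : {set 'I_l} -> V,
         (forall T : {set 'I_l}, #|T|.+1 = i -> M (b T)) /\
         (forall T : {set 'I_l}, #|T|.+1 <> i -> b T = 0) /\
         (forall T : {set 'I_l}, #|T| = i -> c T = kd x b T)).

Definition Kgrade_fg_ge (l : nat) (x : 'I_l -> R) (n : nat) : Prop :=
  forall i, (i < n)%N -> ~ koszul_H_nonzero x i.

Definition Kgrade_ge (a : R -> Prop) (n : nat) : Prop :=
  exists (l : nat) (x : 'I_l -> R), (forall k, a (x k)) /\ Kgrade_fg_ge x n.

End Defs.

(* Cohen–Macaulay in the sense of ideals: ht I = Kgrade_S(I, S) for every
   ideal I (equality of extended naturals, expressed through lower bounds). *)
Definition CM_ideals (R : comNzRingType) (S : R -> Prop) : Prop :=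
  forall I, is_ideal S I ->
    forall n : nat, ht_ge S I n <-> Kgrade_ge (@GRing.mul R) S I n.

Definition bowtie (A B : comNzRingType) (f : A -> B) (J : B -> Prop) : A * B -> Prop :=
  fun p => exists a j, J j /\ p = (a, f a + j).

(* Main.v *)
Require Import Defs.
From mathcomp Require Import boolp classical_sets.
From mathcomp Require Import all_boot all_order all_algebra ring.
Set Implicit Arguments. Unset Strict Implicit. Unset Printing Implicit Defensive.
Import GRing.Theory.
Local Open Scope ring_scope.

(* The elements [(0, j)] with [j] in [J] are nilpotent, so the primes of the bowtie ring
   are the preimages of those of [A] and heights do not change under projection to [A].
   Koszul grade only depends on the radical of the generators, so [(a_k, f a_k + j_k)] may
   be replaced by [(a_k, f a_k)]; the bowtie ring is [A (+) J] as an [A]-module, hence its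
   grade is the minimum of the grades of [A] and of [J].  It remains to know that the grade
   of an ideal of [A] never exceeds its height: by a local Kronecker theorem a finitely
   generated ideal inside a prime [P] of height [d] is, up to radical in the localization
   at [P], generated by [d] elements of [P], whose top Koszul cohomology is nonzero there. *)

(** * Koszul cochains split along one generator *)

Record is_subring (R : comNzRingType) (S : R -> Prop) : Prop := IsSubring {
  subring0 : S 0;
  subring1 : S 1;
  subringD : forall x y, S x -> S y -> S (x + y);
  subringM : forall x y, S x -> S y -> S (x * y) }.

Lemma subringX (R : comNzRingType) (S : R -> Prop) x n :
  is_subring S -> S x -> S (x ^+ n).
Proof.
by case=> _ S1 _ SM Sx; elim: n => [|n IHn]; rewrite ?expr0 ?exprS //; apply: SM.
Qed.

(** The laws of [act] are asked on all of [R] and [V]; only the stability of [M] is relative to [S].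
    Cochains can thus be manipulated without tracking membership. *)
Record is_module (R : comNzRingType) (S : R -> Prop) (V : zmodType)
    (act : R -> V -> V) (M : V -> Prop) : Prop := IsModule {
  actDr : forall r u v, act r (u + v) = act r u + act r v;
  actDl : forall r s v, act (r + s) v = act r v + act s v;
  actA : forall r s v, act r (act s v) = act (r * s) v;
  act1 : forall v, act 1 v = v;
  mod0 : M 0;
  modD : forall u v, M u -> M v -> M (u + v);
  modN : forall v, M v -> M (- v);
  modZ : forall r v, S r -> M v -> M (act r v) }.

Section Sign.
Variable V : zmodType.

Definition sg (b : bool) (v : V) : V := if b then - v else v.

Lemma sg0 b : sg b 0 = 0.
Proof. by case: b; rewrite /sg ?oppr0. Qed.

Lemma sgD b u v : sg b (u + v) = sg b u + sg b v.
Proof. by case: b; rewrite /sg ?opprD. Qed.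

Lemma sg_sg b b' v : sg b (sg b' v) = sg (b (+) b') v.
Proof. by case: b; case: b'; rewrite /sg ?opprK. Qed.

Lemma sgN b v : - sg b v = sg (~~ b) v.
Proof. by case: b; rewrite /sg ?opprK. Qed.

Lemma sg_sum b (I : finType) (P : pred I) (F : I -> V) :
  sg b (\sum_(i | P i) F i) = \sum_(i | P i) sg b (F i).
Proof. by case: b; rewrite /sg // -sumrN. Qed.

(** The sign of sorting [p] into its place in the exterior monomial indexed by [lift p @: T]. *)
Definition eps n (p : 'I_n.+1) (T : {set 'I_n}) :=
  odd #|[set k in T | (lift p k < p)%N]|.

Definition face0 n (p : 'I_n.+1) (c : {set 'I_n.+1} -> V) (T : {set 'I_n}) : V :=
  c (lift p @: T).

(* The sign makes the differential of the [p]-faces independent of [p], see [kd_face1]. *)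
Definition face1 n (p : 'I_n.+1) (c : {set 'I_n.+1} -> V) (T : {set 'I_n}) : V :=
  sg (eps p T) (c (p |: lift p @: T)).

(** The inverse of the splitting of a cochain into [face0] and [face1]. *)
Definition glue n (p : 'I_n.+1) (c0 c1 : {set 'I_n} -> V) (T : {set 'I_n.+1}) : V :=
  let T' := lift p @^-1: T in
  if p \in T then sg (eps p T') (c1 T') else c0 T'.

Lemma lift_notin n (p : 'I_n.+1) (T : {set 'I_n}) : p \notin lift p @: T.
Proof. by apply/imsetP => -[j _] /eqP; rewrite eq_liftF. Qed.

Lemma preim_lift n (p : 'I_n.+1) (T : {set 'I_n}) : lift p @^-1: (lift p @: T) = T.
Proof. by apply/setP => k; rewrite inE mem_imset //; apply: lift_inj. Qed.

Lemma preim_liftU n (p : 'I_n.+1) (T : {set 'I_n}) :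
  lift p @^-1: (p |: lift p @: T) = T.
Proof.
apply/setP => k; rewrite !inE lift_eqF /= mem_imset //; exact: lift_inj.
Qed.

Lemma set_liftE n (p : 'I_n.+1) (T : {set 'I_n.+1}) :
  T = if p \in T then p |: lift p @: (lift p @^-1: T)
      else lift p @: (lift p @^-1: T).
Proof.
apply/setP => k; case: ifP => pT.
  rewrite !inE; case: (unliftP p k) => [j ->|->]; last by rewrite eqxx.
  by rewrite lift_eqF /= mem_imset ?inE //; apply: lift_inj.
case: (unliftP p k) => [j ->|->]; last by rewrite pT (negbTE (lift_notin _ _)).
by rewrite mem_imset ?inE //; apply: lift_inj.
Qed.

Lemma face0_glue n (p : 'I_n.+1) c0 c1 T : face0 p (glue p c0 c1) T = c0 T.
Proof. by rewrite /face0 /glue (negbTE (lift_notin _ _)) preim_lift. Qed.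

Lemma face1_glue n (p : 'I_n.+1) c0 c1 T : face1 p (glue p c0 c1) T = c1 T.
Proof. by rewrite /face1 /glue preim_liftU setU11 sg_sg addbb. Qed.

Lemma eq_faces n (p : 'I_n.+1) (u v : {set 'I_n.+1} -> V) :
  (forall T, face0 p u T = face0 p v T) -> (forall T, face1 p u T = face1 p v T) ->
  forall T, u T = v T.
Proof.
move=> e0 e1 T; rewrite (set_liftE p T); case: ifP => _; last exact: e0.
have := congr1 (sg (eps p (lift p @^-1: T))) (e1 (lift p @^-1: T)).
by rewrite /face1 !sg_sg !addbb.
Qed.

End Sign.

(** * The Koszul differential as a mapping cone *)

Section Kd.
Variables (R : comNzRingType) (S : R -> Prop) (V : zmodType) (act : R -> V -> V).
Variable M : V -> Prop.
Hypothesis Mmod : is_module S act M.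

Lemma actr0 r : act r 0 = 0.
Proof. by apply: (addrI (act r 0)); rewrite -(actDr Mmod) !addr0. Qed.

Lemma actrN r v : act r (- v) = - act r v.
Proof. by apply: (addrI (act r v)); rewrite -(actDr Mmod) !subrr actr0. Qed.

Lemma act_sg r b v : act r (sg b v) = sg b (act r v).
Proof. by case: b; rewrite /sg ?actrN. Qed.

Lemma act_sum r (I : finType) (P : pred I) (F : I -> V) :
  act r (\sum_(i | P i) F i) = \sum_(i | P i) act r (F i).
Proof. exact: (big_morph _ (actDr Mmod r) (actr0 r)). Qed.

Lemma actC r s v : act r (act s v) = act s (act r v).
Proof. by rewrite !(actA Mmod) mulrC. Qed.

Lemma modB u v : M u -> M v -> M (u - v).
Proof. by move=> Mu Mv; apply: (modD Mmod) => //; apply: (modN Mmod). Qed.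

Lemma mod_sg b v : M v -> M (sg b v).
Proof. by case: b => //; apply: (modN Mmod). Qed.

Lemma kdE l (x : 'I_l -> R) c T : kd act x c T =
  \sum_(j in T) sg (odd #|[set k in T | (k < j)%N]|) (act (x j) (c (T :\ j))).
Proof. by []. Qed.

Lemma eq_kd l (x : 'I_l -> R) c c' T : (forall T, c T = c' T) -> kd act x c T = kd act x c' T.
Proof. by move=> e; rewrite !kdE; apply: eq_bigr => j _; rewrite e. Qed.

Lemma eq_kdx l (x x' : 'I_l -> R) c T : (forall k, x k = x' k) -> kd act x c T = kd act x' c T.
Proof. by move=> e; rewrite !kdE; apply: eq_bigr => j _; rewrite e. Qed.

Lemma kdD l (x : 'I_l -> R) c c' T :
  kd act x (fun T => c T + c' T) T = kd act x c T + kd act x c' T.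
Proof.
rewrite !kdE -big_split; apply: eq_bigr => j _ /=.
by rewrite (actDr Mmod) sgD.
Qed.

Lemma kd_act l (x : 'I_l -> R) r c T :
  kd act x (fun T => act r (c T)) T = act r (kd act x c T).
Proof.
rewrite !kdE act_sum; apply: eq_bigr => j _ /=.
by rewrite actC act_sg.
Qed.

Lemma kd0 l (x : 'I_l -> R) T : kd act x (fun=> 0) T = 0.
Proof. by rewrite kdE big1 // => j _; rewrite actr0 sg0. Qed.

Lemma kdN l (x : 'I_l -> R) c T : kd act x (fun T => - c T) T = - kd act x c T.
Proof.
apply: (addrI (kd act x c T)); rewrite -kdD subrr -(kd0 x T).
by apply: eq_kd => T'; rewrite subrr.
Qed.

Lemma kdB l (x : 'I_l -> R) c c' T :
  kd act x (fun T => c T - c' T) T = kd act x c T - kd act x c' T.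
Proof. by rewrite kdD kdN. Qed.

Lemma ltn_lift n (p : 'I_n.+1) (i j : 'I_n) : (lift p i < lift p j)%N = (i < j)%N.
Proof. by rewrite !ltnNge /= leq_bump2. Qed.

Lemma lift_setD1 n (p : 'I_n.+1) (T : {set 'I_n}) j :
  lift p @: T :\ lift p j = lift p @: (T :\ j).
Proof.
apply/setP => k; rewrite !inE; case: (unliftP p k) => [i ->|->].
  by rewrite (inj_eq lift_inj) !mem_imset ?inE //; apply: lift_inj.
by rewrite !(negbTE (lift_notin _ _)) andbF.
Qed.

Lemma liftU_setD1 n (p : 'I_n.+1) (T : {set 'I_n}) j :
  (p |: lift p @: T) :\ lift p j = p |: lift p @: (T :\ j).
Proof.
apply/setP => k; rewrite -lift_setD1 !inE.
by case: (k =P p) => [->|_] //=; rewrite eq_liftF.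
Qed.

Lemma card_lift_lt n (p : 'I_n.+1) (T : {set 'I_n}) (j : 'I_n) :
  #|[set k in lift p @: T | (k < lift p j)%N]| = #|[set k in T | (k < j)%N]|.
Proof.
rewrite -(card_imset (mem [set k in T | (k < j)%N]) (@lift_inj _ p)); apply: eq_card => k.
rewrite !inE; case: (unliftP p k) => [i ->|->].
  by rewrite !mem_imset ?inE ?ltn_lift //; apply: lift_inj.
rewrite (negbTE (lift_notin _ _)) /=; apply/esym/negbTE; exact: lift_notin.
Qed.

Lemma card_liftU_lt n (p : 'I_n.+1) (T : {set 'I_n}) (j : 'I_n) :
  #|[set k in p |: lift p @: T | (k < lift p j)%N]| =
  ((p < lift p j)%N + #|[set k in T | (k < j)%N]|)%N.
Proof.
rewrite -(card_lift_lt p) (cardsD1 p) !inE eqxx /=; congr (_ + _)%N.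
apply: eq_card => k; rewrite !inE; case: (k =P p) => [->|_] //=.
by rewrite (negbTE (lift_notin _ _)).
Qed.

Lemma card_liftU_ltp n (p : 'I_n.+1) (T : {set 'I_n}) :
  odd #|[set k in p |: lift p @: T | (k < p)%N]| = eps p T.
Proof.
rewrite /eps -(card_imset (mem [set k in T | (lift p k < p)%N]) (@lift_inj _ p)); congr odd.
apply: eq_card => k; rewrite !inE; case: (unliftP p k) => [i ->|->].
  by rewrite lift_eqF /= !mem_imset ?inE //; apply: lift_inj.
rewrite ltnn andbF; apply/esym/negbTE; exact: lift_notin.
Qed.

Lemma eps_setD1 n (p : 'I_n.+1) (T : {set 'I_n}) (j : 'I_n) : j \in T ->
  eps p T = (lift p j < p)%N (+) eps p (T :\ j).
Proof.
move=> jT; rewrite /eps (cardsD1 j) oddD !inE jT oddb /=; congr (_ (+) odd _).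
by apply: eq_card => k; rewrite !inE andbA.
Qed.

Variables (n : nat) (p : 'I_n.+1) (x : 'I_n.+1 -> R) (c : {set 'I_n.+1} -> V).

Lemma kd_face0 T : face0 p (kd act x c) T = kd act (x \o lift p) (face0 p c) T.
Proof.
rewrite /face0 !kdE big_imset /=; last by move=> i j _ _; apply: lift_inj.
by apply: eq_bigr => j _; rewrite lift_setD1 card_lift_lt.
Qed.

(** Together with [kd_face0], this presents the Koszul complex as the mapping cone of multiplication
    by [x p] on the complex of the other generators. *)
Lemma kd_face1 T : face1 p (kd act x c) T =
  act (x p) (face0 p c T) - kd act (x \o lift p) (face1 p c) T.
Proof.
rewrite /face1 kdE big_setU1 ?lift_notin //= sgD card_liftU_ltp sg_sg addbb.
rewrite setU1K ?lift_notin // /face0; congr (_ + _).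
rewrite big_imset /=; last by move=> i j _ _; apply: lift_inj.
rewrite sg_sum kdE -sumrN; apply: eq_bigr => j jT.
rewrite liftU_setD1 act_sg sgN !sg_sg card_liftU_lt oddD oddb (eps_setD1 p jT).
(* The count for [p |: lift p @: T] gains one if [p] is below [lift p j], and [eps] loses one if it
   is above. Exactly one of these happens, whence the minus sign. *)
congr sg; have: (p < lift p j)%N = ~~ (lift p j < p)%N.
  by rewrite -leqNgt ltn_neqAle neq_lift.
by move=> ->; case: (_ < _)%N; case: (eps _ _); case: (odd _).
Qed.

End Kd.

(** * Koszul grade and radicals *)

(* Cochains of degree [i - e]; the offset [e] makes sense of degree [-1]. *)
Definition coch (V : zmodType) (M : V -> Prop) (e i l : nat) (c : {set 'I_l} -> V) :=
  forall T : {set 'I_l}, if (#|T| + e == i)%N then M (c T) else c T = 0.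

(** For [i = e] the offset [e.+1] forces [b = 0], so degree zero is no special case. *)
Definition cobound (R : comNzRingType) (V : zmodType) (act : R -> V -> V) (M : V -> Prop)
    (e i l : nat) (x : 'I_l -> R) (c : {set 'I_l} -> V) :=
  exists b, coch M e.+1 i b /\ forall T, c T = kd act x b T.

(* The grade of the localization at [W], without forming the localization:
   below degree [n] every cohomology class is annihilated by an element of [W]. *)
Definition kgr (R : comNzRingType) (V : zmodType) (act : R -> V -> V) (M : V -> Prop)
    (W : R -> Prop) (n l : nat) (x : 'I_l -> R) :=
  forall i, (i < n)%N -> forall c, coch M 0 i c -> (forall T, kd act x c T = 0) ->
  exists s, W s /\ cobound act M 0 i x (fun T => act s (c T)).

Section Grade.
Variables (R : comNzRingType) (S : R -> Prop) (V : zmodType) (act : R -> V -> V).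
Variable M : V -> Prop.
Hypothesis Mmod : is_module S act M.
Hypothesis Ssub : is_subring S.

(** With [W] reduced to [1] nothing is localized; classically, a class that is not nonzero has a
    bounding cochain. *)
Lemma Kgrade_fg_geE n l (x : 'I_l -> R) :
  Kgrade_fg_ge act M x n <-> kgr act M (eq 1) n x.
Proof.
split=> H i lt_in => [c Mc dc|].
  apply: contrapT => nb; apply: (H i lt_in); exists c; split=> [T Ti|].
    by have := Mc T; rewrite addn0 Ti eqxx.
  split=> [T /eqP/negbTE Ti|]; first by have := Mc T; rewrite addn0 Ti.
  split=> // -[b [Mb [b0 cb]]]; apply: nb; exists 1; split=> //; exists b.
  split=> [T|T]; first by case: eqP; rewrite addn1 => e; [exact: Mb|exact: b0].
  (* [koszul_H_nonzero] compares [c] with the differential of [b] in degree [i] only; elsewhere both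
     vanish, as [T :\ j] then has the wrong size for [b]. *)
  rewrite (act1 Mmod); have [/cb //|/eqP/negbTE Ti] := pselect (#|T| = i).
  have := Mc T; rewrite addn0 Ti => ->; rewrite kdE big1 // => j jT.
  rewrite b0 ?(actr0 Mmod) ?sg0 // => e.
  by move: Ti; rewrite (cardsD1 j) jT add1n e eqxx.
move=> [c [Mc [c0 [dc nb]]]]; apply: nb.
have [|s [<- [b [Mb cb]]]] := H i lt_in c _ dc.
  by move=> T; rewrite addn0; case: eqP => [/Mc|/c0].
exists b; split=> [T Ti|]; first by have := Mb T; rewrite addn1 Ti eqxx.
split=> [T /eqP/negbTE Ti|T _]; first by have := Mb T; rewrite addn1 Ti.
by rewrite -cb (act1 Mmod).
Qed.

Lemma coch_shift e i l (c : {set 'I_l} -> V) :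
  (e <= i)%N -> coch M e i c <-> coch M 0 (i - e) c.
Proof.
move=> le_ei; have E (T : {set 'I_l}) : (#|T| + e == i)%N = (#|T| + 0 == i - e)%N.
  by rewrite addn0 -(eqn_add2r e #|T|) subnK.
by split=> H T; have := H T; rewrite E.
Qed.

Lemma coch_neg e i l (c : {set 'I_l} -> V) : (i < e)%N -> coch M e i c -> forall T, c T = 0.
Proof.
move=> lt_ie Mc T; have := Mc T; case: eqP => // Ti.
by move: lt_ie; rewrite -Ti ltnNge leq_addl.
Qed.

Lemma coch0 e i l : coch M e i (fun _ : {set 'I_l} => 0).
Proof. by move=> T; case: eqP => // _; apply: (mod0 Mmod). Qed.

Lemma cochB e i l (c c' : {set 'I_l} -> V) :
  coch M e i c -> coch M e i c' -> coch M e i (fun T => c T - c' T).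
Proof.
move=> Mc Mc' T; move: (Mc T) (Mc' T); case: eqP => _; first exact: (modB Mmod).
by move=> -> ->; rewrite subrr.
Qed.

Lemma cochD e i l (c c' : {set 'I_l} -> V) :
  coch M e i c -> coch M e i c' -> coch M e i (fun T => c T + c' T).
Proof.
move=> Mc Mc' T; move: (Mc T) (Mc' T); case: eqP => _; first exact: (modD Mmod).
by move=> -> ->; rewrite addr0.
Qed.

Lemma coch_act e i l r (c : {set 'I_l} -> V) :
  S r -> coch M e i c -> coch M e i (fun T => act r (c T)).
Proof.
move=> Sr Mc T; move: (Mc T); case: eqP => _; first exact: (modZ Mmod).
by move=> ->; rewrite (actr0 Mmod).
Qed.

Lemma card_lift_setU n (p : 'I_n.+1) (T : {set 'I_n}) : #|p |: lift p @: T| = #|T|.+1.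
Proof. by rewrite cardsU1 lift_notin card_imset //; apply: lift_inj. Qed.

Lemma coch_face0 e i n (p : 'I_n.+1) c : coch M e i c -> coch M e i (face0 p c).
Proof. by move=> Mc T; have := Mc (lift p @: T); rewrite card_imset //; apply: lift_inj. Qed.

Lemma coch_face1 e i n (p : 'I_n.+1) c : coch M e i c -> coch M e.+1 i (face1 p c).
Proof.
move=> Mc T; have := Mc (p |: lift p @: T); rewrite card_lift_setU addSnnS /face1.
by case: eqP => _ => [|->]; [apply: (mod_sg Mmod)|rewrite sg0].
Qed.

Lemma coch_glue e i n (p : 'I_n.+1) c0 c1 :
  coch M e i c0 -> coch M e.+1 i c1 -> coch M e i (glue p c0 c1).
Proof.
move=> M0 M1 T; rewrite /glue.
have := congr1 (fun U : {set _} => #|U|) (set_liftE p T); case: ifP => pT ->.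
  rewrite card_lift_setU addSnnS; have := M1 (lift p @^-1: T).
  by case: eqP => _ => [|->]; [apply: (mod_sg Mmod)|rewrite sg0].
by rewrite card_imset; [exact: M0|exact: lift_inj].
Qed.

Lemma cobound_act e i l (x : 'I_l -> R) c r : S r ->
  cobound act M e i x c -> cobound act M e i x (fun T => act r (c T)).
Proof.
move=> Sr [b [Mb cb]]; exists (fun T => act r (b T)); split; first exact: coch_act.
by move=> T; rewrite (kd_act Mmod) cb.
Qed.

Lemma coboundD e i l (x : 'I_l -> R) c c' :
  cobound act M e i x c -> cobound act M e i x c' ->
  cobound act M e i x (fun T => c T + c' T).
Proof.
move=> [b [Mb cb]] [b' [Mb' cb']]; exists (fun T => b T + b' T).
by split=> [|T]; [exact: cochD|rewrite (kdD Mmod) cb cb'].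
Qed.

Lemma cobound0 e i l (x : 'I_l -> R) : cobound act M e i x (fun=> 0).
Proof. by exists (fun=> 0); split=> [|T]; [exact: coch0|rewrite (kd0 Mmod)]. Qed.

Lemma eq_cobound e i l (x : 'I_l -> R) c c' :
  (forall T, c T = c' T) -> cobound act M e i x c -> cobound act M e i x c'.
Proof. by move=> ec [b [Mb cb]]; exists b; split=> // T; rewrite -ec. Qed.

(* If [c = (c0, c1)] is the splitting of the cocycle [c] at [p], then
   [x_p c] is the coboundary of [(c1, 0)]. *)
Lemma generator_kills e i l (x : 'I_l -> R) c (p : 'I_l) : (forall k, S (x k)) ->
  coch M e i c -> (forall T, kd act x c T = 0) ->
  cobound act M e i x (fun T => act (x p) (c T)).
Proof.
case: l x c p => [|l] x c p Sx Mc dc; first by case: p.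
exists (glue p (face1 p c) (fun=> 0)); split.
  by apply: coch_glue; [exact: coch_face1|exact: coch0].
have d1 T : act (x p) (face0 p c T) = kd act (x \o lift p) (face1 p c) T.
  by apply/eqP; rewrite -subr_eq0 -(kd_face1 Mmod) /face1 dc sg0.
apply: (@eq_faces _ _ p) => T.
  rewrite kd_face0 (eq_kd _ _ _ (c' := face1 p c)); last exact: face0_glue.
  by rewrite -d1.
rewrite (kd_face1 Mmod) face0_glue (eq_kd _ _ _ (c' := fun=> 0)); last exact: face1_glue.
by rewrite (kd0 Mmod) subr0 /face1 (act_sg Mmod).
Qed.

(** The scalars of [S] that turn a fixed cocycle into a coboundary are closed under sums and
    multiples, and include each generator. *)
Lemma span_kills e i l (x a : 'I_l -> R) c : (forall k, S (x k)) -> (forall k, S (a k)) ->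
  coch M e i c -> (forall T, kd act x c T = 0) ->
  cobound act M e i x (fun T => act (\sum_k a k * x k) (c T)).
Proof.
move=> Sx Sa Mc dc; elim/big_rec: _ => [|k z _ bz].
  have act0 v : act 0 v = 0.
    by apply: (addrI (act 0 v)); rewrite -(actDl Mmod) !addr0.
  by apply: eq_cobound (cobound0 _ _ _) => T.
have := coboundD (cobound_act (Sa k) (generator_kills k Sx Mc dc)) bz.
by apply: eq_cobound => T; rewrite (actDl Mmod) (actA Mmod).
Qed.

Variable W : R -> Prop.
Hypothesis (WS : forall s, W s -> S s) (W1 : W 1) (WM : forall s t, W s -> W t -> W (s * t)).

(** Serves the component [face1], which lives one degree lower; for [i < e] the cochain is zero. *)
Lemma kgr_shift n l (x : 'I_l -> R) e i c : kgr act M W n x -> (i < n)%N ->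
  coch M e i c -> (forall T, kd act x c T = 0) ->
  exists s, W s /\ cobound act M e i x (fun T => act s (c T)).
Proof.
move=> H lt_in Mc dc; have [le_ei|lt_ie] := leqP e i; last first.
  exists 1; split=> //; apply: eq_cobound (cobound0 _ _ _) => T.
  by rewrite (coch_neg lt_ie Mc) (actr0 Mmod).
have [|s [Ws [b [Mb cb]]]] := H _ (leq_ltn_trans (leq_subr e i) lt_in) c _ dc.
  exact/(coch_shift c le_ei).
exists s; split=> //; exists b; split=> // T; have := Mb T.
suff -> : (#|T| + e.+1 == i)%N = (#|T| + 1 == i - e)%N by [].
by rewrite -[RHS](eqn_add2r e) (subnK le_ei) addnAC addn1 addnS.
Qed.

(** This is the long exact sequence of the mapping cone, carried out on cochains. *)
Lemma kgr_insert n l (x : 'I_l.+1 -> R) (p : 'I_l.+1) : S (x p) ->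
  kgr act M W n (x \o lift p) -> kgr act M W n x.
Proof.
move=> Sp H i lt_in c Mc dc; pose x' := x \o lift p.
have dc0 T : kd act x' (face0 p c) T = 0 by rewrite -kd_face0 /face0 dc.
have dc1 T : kd act x' (face1 p c) T = act (x p) (face0 p c T).
  by apply/esym/eqP; rewrite -subr_eq0 -(kd_face1 Mmod) /face1 dc sg0.
have [s [Ws [b0 [Mb0 cb0]]]] := kgr_shift H lt_in (coch_face0 p Mc) dc0.
have Ss := WS Ws.
(* The error left when [(b0, 0)] is taken to bound [s c]: a cocycle on the remaining generators, one
   degree lower, which is bounded in turn. *)
pose u T := act (x p) (b0 T) - act s (face1 p c T).
have Mu : coch M 1 i u by apply: cochB; apply: coch_act => //; exact: coch_face1.
have du T : kd act x' u T = 0.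
  by rewrite (kdB Mmod) !(kd_act Mmod) -cb0 dc1 (actC Mmod) subrr.
have [t [Wt [b1 [Mb1 cb1]]]] := kgr_shift H lt_in Mu du; have St := WS Wt.
exists (t * s); split; first exact: WM.
exists (glue p (fun T => act t (b0 T)) b1); split.
  by apply: coch_glue => //; apply: coch_act.
apply: (@eq_faces _ _ p) => T.
  rewrite kd_face0 (eq_kd _ _ _ (c' := fun T => act t (b0 T))); last exact: face0_glue.
  by rewrite (kd_act Mmod) -cb0 (actA Mmod).
rewrite (kd_face1 Mmod) face0_glue (eq_kd _ _ _ (c' := b1)); last exact: face1_glue.
rewrite -cb1 /u (actDr Mmod) (actrN Mmod) (actC Mmod) opprD opprK addrA subrr add0r.
by rewrite /face1 (actA Mmod) (act_sg Mmod).
Qed.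

(** By [span_kills], [s0 * x p ^+ N] kills the cohomology of the remaining generators; the factors
    [x p] are then removed one at a time. *)
Lemma kgr_delete n l (x : 'I_l.+1 -> R) (p : 'I_l.+1) s0 N (a : 'I_l -> R) :
  (forall k, S (x k)) -> (forall k, S (a k)) -> W s0 ->
  s0 * x p ^+ N = \sum_k a k * x (lift p k) ->
  kgr act M W n x -> kgr act M W n (x \o lift p).
Proof.
move=> Sx Sa Ws0 rad H i lt_in; pose x' := x \o lift p.
have SX m : S (x p ^+ m) by apply: subringX.
(* If [b] bounds [x_p^(m+1) c], then [(x_p^m c, b)] is a cocycle for all generators. Bounding it
   bounds [x_p^m c] up to a factor in [W]. *)
have key m c : coch M 0 i c -> (forall T, kd act x' c T = 0) ->
    cobound act M 0 i x' (fun T => act (x p ^+ m) (c T)) ->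
    exists s, W s /\ cobound act M 0 i x' (fun T => act s (c T)).
  elim: m c => [|m IHm] c Mc dc; first by exists 1.
  move=> [b [Mb cb]]; pose C := glue p (fun T => act (x p ^+ m) (c T)) b.
  have MC : coch M 0 i C by apply: coch_glue => //; apply: coch_act.
  have dC T : kd act x C T = 0.
    move: T; apply: (@eq_faces _ _ p) => T.
      rewrite kd_face0 (eq_kd _ _ _ (c' := fun T => act (x p ^+ m) (c T))); last exact: face0_glue.
      by rewrite (kd_act Mmod) dc (actr0 Mmod).
    rewrite (kd_face1 Mmod) face0_glue (eq_kd _ _ _ (c' := b)); last exact: face1_glue.
    by rewrite (actA Mmod) -exprS -cb subrr /face1 sg0.
  have [s [Ws [B [MB cB]]]] := H i lt_in C MC dC.
  have Ss := WS Ws.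
  have [||| t [Wt bt]] := IHm (fun T => act s (c T)).
  - exact: coch_act.
  - by move=> T; rewrite (kd_act Mmod) dc (actr0 Mmod).
  - exists (face0 p B); split=> [|T]; first exact: coch_face0.
    by rewrite -kd_face0 /face0 -cB -/(face0 p C T) face0_glue (actC Mmod).
  exists (t * s); split; first exact: WM.
  by apply: eq_cobound bt => T; rewrite (actA Mmod).
move=> c Mc dc.
have [||| t [Wt bt]] := key N (fun T => act s0 (c T)).
- by apply: coch_act => //; apply: WS.
- by move=> T; rewrite (kd_act Mmod) dc (actr0 Mmod).
- have := span_kills (x := x') (a := a) (fun k => Sx (lift p k)) Sa Mc dc.
  by apply: eq_cobound => T; rewrite -rad (actA Mmod) mulrC.
exists (t * s0); split; first exact: WM.
by apply: eq_cobound bt => T; rewrite (actA Mmod).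
Qed.

Lemma eq_kgr n l (x y : 'I_l -> R) : (forall k, x k = y k) -> kgr act M W n x -> kgr act M W n y.
Proof. by move=> e; have -> : y = x by apply/funext. Qed.

(** Sequences are indexed by [nat] here, so that concatenation is a shift of indices and not a cast
    between ordinals. *)
Lemma kgr_prepend n m l (x : nat -> R) : (forall k, S (x k)) ->
  kgr act M W n (fun i : 'I_l => x (m + i)%N) -> kgr act M W n (fun i : 'I_(m + l) => x i).
Proof.
elim: m x => [|m IHm] x Sx H; first exact: H.
apply: (@kgr_insert n (m + l) _ ord0) => //.
by apply: (IHm (fun i => x i.+1)) => // k; apply: Sx.
Qed.

Lemma kgr_append n m l (x : nat -> R) : (forall k, S (x k)) ->
  kgr act M W n (fun i : 'I_m => x i) -> kgr act M W n (fun i : 'I_(m + l) => x i).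
Proof.
move=> Sx H; elim: l => [|l IHl]; first by rewrite addn0.
rewrite addnS; apply: (@kgr_insert n (m + l) _ ord_max) => //.
by apply: eq_kgr IHl => k; rewrite -(lift_max k).
Qed.

Lemma kgr_truncate n m l (x : nat -> R) : (forall k, S (x k)) ->
  (forall k, (k < l)%N -> exists s N (a : nat -> R), [/\ W s, forall j, S (a j)
     & s * x (m + k)%N ^+ N = \sum_(j < m) a j * x j]) ->
  kgr act M W n (fun i : 'I_(m + l) => x i) -> kgr act M W n (fun i : 'I_m => x i).
Proof.
move=> Sx; elim: l => [|l IHl] rad; first by rewrite addn0.
rewrite addnS => H; apply: IHl; first by move=> k kl; apply: rad; rewrite ltnS ltnW.
have [s [N [a [Ws Sa sa]]]] := rad l (ltnSn l).
(* Padding by zero: the terms from [m] to [m + l - 1] are still present when the last one is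
   deleted. *)
pose a' j := if (j < m)%N then a j else 0.
apply: (eq_kgr _ (kgr_delete (p := ord_max) (s0 := s) (N := N)
   (a := fun j : 'I_(m + l) => a' j) _ _ Ws _ H)) => //.
- by move=> k; rewrite -(lift_max k).
- by move=> k; rewrite /a'; case: ifP => // _; apply: subring0.
- rewrite sa big_split_ord /= [X in _ + X]big1 ?addr0 => [|j _].
    by apply: eq_bigr => j _; rewrite /a' ltn_ord /bump leqNgt ltn_addr.
  by rewrite /a' /= ltnNge leq_addr mul0r.
Qed.

(* Pass through the concatenation of [y] and [x]. *)
Lemma kgr_radical n l m (x y : nat -> R) : (forall k, S (x k)) -> (forall k, S (y k)) ->
  (forall k, (k < l)%N -> exists s N (a : nat -> R), [/\ W s, forall j, S (a j)
     & s * x k ^+ N = \sum_(j < m) a j * y j]) ->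
  kgr act M W n (fun i : 'I_l => x i) -> kgr act M W n (fun i : 'I_m => y i).
Proof.
move=> Sx Sy rad H; pose X j := if (j < m)%N then y j else x (j - m)%N.
have SX j : S (X j) by rewrite /X; case: ifP.
have Xx k : X (m + k)%N = x k by rewrite /X ltnNge leq_addr addKn.
have Xy (j : 'I_m) : X j = y j by rewrite /X ltn_ord.
apply: (eq_kgr Xy); apply: (@kgr_truncate n m l) => // [k /rad[s [N [a [Ws Sa sa]]]]|].
  exists s, N, a; split=> //; rewrite Xx sa.
  by apply: eq_bigr => j _; rewrite Xy.
by apply: kgr_prepend => //; apply: eq_kgr H => k; rewrite Xx.
Qed.

End Grade.

(** * Koszul complexes of direct sums *)

Section KoszulMaps.
Variables (l : nat) (R R' : comNzRingType) (V V' : zmodType).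
Variables (act : R -> V -> V) (act' : R' -> V' -> V') (M : V -> Prop) (M' : V' -> Prop).
Variables (x : 'I_l -> R) (x' : 'I_l -> R').

(** Compatibility is required only with the scalars [x k], the ones in the differential; the two
    modules may thus live over different rings. *)
Record koszul_map (phi : V -> V') : Prop := KoszulMap {
  kmapD : forall u v, phi (u + v) = phi u + phi v;
  kmap_act : forall k v, phi (act (x k) v) = act' (x' k) (phi v);
  kmapM : forall v, M v -> M' (phi v) }.

Variable phi : V -> V'.
Hypothesis phiP : koszul_map phi.

Lemma kmap0 : phi 0 = 0.
Proof. by apply: (addrI (phi 0)); rewrite -(kmapD phiP) !addr0. Qed.

Lemma kmap_sg b v : phi (sg b v) = sg b (phi v).
Proof.
case: b => //=; apply: (addrI (phi v)).
by rewrite -(kmapD phiP) !subrr kmap0.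
Qed.

Lemma kmap_kd c T : phi (kd act x c T) = kd act' x' (phi \o c) T.
Proof.
rewrite !kdE (big_morph phi (kmapD phiP) kmap0); apply: eq_bigr => j _.
by rewrite kmap_sg (kmap_act phiP).
Qed.

Lemma kmap_coch e i (c : {set 'I_l} -> V) : coch M e i c -> coch M' e i (phi \o c).
Proof.
move=> Mc T; have := Mc T; case: eqP => _ /=; first exact: (kmapM phiP).
by move=> ->; apply: kmap0.
Qed.

Lemma kmap_cobound i (c : {set 'I_l} -> V) :
  cobound act M 0 i x c -> cobound act' M' 0 i x' (phi \o c).
Proof.
move=> [b [Mb cb]]; exists (phi \o b); split; first exact: kmap_coch.
by move=> T; rewrite -kmap_kd -cb.
Qed.

End KoszulMaps.

Section Summand.
Variables (l : nat) (R R' : comNzRingType) (V V' : zmodType).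
Variables (act : R -> V -> V) (act' : R' -> V' -> V') (M : V -> Prop) (M' : V' -> Prop).
Variables (x : 'I_l -> R) (x' : 'I_l -> R').
Hypotheses (act1 : forall v, act 1 v = v) (act'1 : forall v, act' 1 v = v).
Variables (phi : V -> V') (psi : V' -> V).
Hypotheses (phiP : koszul_map act act' M M' x x' phi).
Hypotheses (psiP : koszul_map act' act M' M x' x psi).

(** A cocycle is sent to the larger module by [psi], bounded there, and brought back by [phi]. *)
Lemma kgr_summand n : (forall v, phi (psi v) = v) ->
  kgr act M (eq 1) n x -> kgr act' M' (eq 1) n x'.
Proof.
move=> phiK H i lt_in c Mc dc.
have [|s [<- bc]] := H i lt_in (psi \o c) (kmap_coch psiP Mc).
  by move=> T; rewrite -(kmap_kd psiP) dc (kmap0 psiP).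
exists 1; split=> //; apply: eq_cobound (kmap_cobound phiP bc) => T /=.
by rewrite act1 act'1 phiK.
Qed.

End Summand.

Lemma kgr_direct_sum l (R R1 R2 : comNzRingType) (V V1 V2 : zmodType)
    (act : R -> V -> V) (act' : R1 -> V1 -> V1) (act'' : R2 -> V2 -> V2)
    (S M : _ -> Prop) M1 M2 (x : 'I_l -> R) (x1 : 'I_l -> R1) (x2 : 'I_l -> R2)
    (phi1 : V -> V1) (phi2 : V -> V2) (psi1 : V1 -> V) (psi2 : V2 -> V) n :
  is_module S act M ->
  (forall v, act' 1 v = v) -> (forall v, act'' 1 v = v) ->
  koszul_map act act' M M1 x x1 phi1 -> koszul_map act act'' M M2 x x2 phi2 ->
  koszul_map act' act M1 M x1 x psi1 -> koszul_map act'' act M2 M x2 x psi2 ->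
  (forall v, psi1 (phi1 v) + psi2 (phi2 v) = v) ->
  kgr act' M1 (eq 1) n x1 -> kgr act'' M2 (eq 1) n x2 -> kgr act M (eq 1) n x.
Proof.
move=> Mm one1 one2 phi1P phi2P psi1P psi2P dec H1 H2 i lt_in c Mc dc.
have [|s1 [<- b1]] := H1 i lt_in (phi1 \o c) (kmap_coch phi1P Mc).
  by move=> T; rewrite -(kmap_kd phi1P) dc (kmap0 phi1P).
have [|s2 [<- b2]] := H2 i lt_in (phi2 \o c) (kmap_coch phi2P Mc).
  by move=> T; rewrite -(kmap_kd phi2P) dc (kmap0 phi2P).
exists 1; split=> //.
apply: eq_cobound (coboundD Mm (kmap_cobound psi1P b1) (kmap_cobound psi2P b2)) => T /=.
by rewrite one1 one2 dec (act1 Mm).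
Qed.

(** * Grade is at most height *)

Section Primes.
Variable A : comNzRingType.
Notation ideal := (is_ideal (fun _ : A => True)).
Notation prime := (is_prime (fun _ : A => True)).
Implicit Types (I P Q : A -> Prop).

Lemma idealM I r x : ideal I -> I x -> I (r * x).
Proof. by case=> _ [_ [_ [_ IM]]] Ix; apply: IM. Qed.

Lemma zero_ideal : ideal (eq^~ 0).
Proof.
split=> //; split=> //; split=> [u v -> ->|]; first by rewrite addr0.
by split=> [u ->|s u _ ->]; rewrite ?oppr0 ?mulr0.
Qed.

Lemma ideal_sum I m (F : 'I_m -> A) : ideal I -> (forall k, I (F k)) -> I (\sum_k F k).
Proof.
by case=> _ [I0 [ID _]] IF; elim/big_rec: _ => // k z _ Iz; apply: ID.
Qed.

Lemma prime_exp P s x N : prime P -> P (s * x ^+ N) -> P s \/ P x.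
Proof.
move=> [_ [P1 PM]]; elim: N s => [|N IHN] s; first by rewrite expr0 mulr1; left.
by rewrite exprS mulrCA => /PM[] // Px; [right|exact: IHN].
Qed.

(** The base [I] may be any ideal, finitely generated or not; it will be a boundary ideal. *)
Definition gen I (m : nat) (y : nat -> A) (z : A) : Prop :=
  exists q (c : nat -> A), I q /\ z = q + \sum_(k < m) c k * y k.

Lemma gen_ideal I m y : ideal I -> ideal (gen I m y).
Proof.
move=> [_ [I0 [ID [IN IM]]]]; split=> //; split; last split; last split.
- exists 0, (fun=> 0); split=> //.
  by rewrite big1 ?addr0 // => k _; rewrite mul0r.
- move=> _ _ [q [c [Iq ->]]] [q' [c' [Iq' ->]]].
  exists (q + q'), (fun k => c k + c' k); split; first exact: ID.
  rewrite addrACA -big_split /=; congr (_ + _).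
  by apply: eq_bigr => k _; rewrite mulrDl.
- move=> _ [q [c [Iq ->]]]; exists (- q), (fun k => - c k); split; first exact: IN.
  rewrite opprD -sumrN; congr (_ + _).
  by apply: eq_bigr => k _; rewrite mulNr.
- move=> s _ _ [q [c [Iq ->]]]; exists (s * q), (fun k => s * c k); split; first exact: IM.
  rewrite mulrDr mulr_sumr; congr (_ + _).
  by apply: eq_bigr => k _; rewrite mulrA.
Qed.

Lemma gen_base I m y z : I z -> gen I m y z.
Proof.
move=> Iz; exists z, (fun=> 0); split=> //.
by rewrite big1 ?addr0 // => k _; rewrite mul0r.
Qed.

Lemma gen_mem I m y k : ideal I -> (k < m)%N -> gen I m y (y k).
Proof.
move=> [_ [I0 _]] km; exists 0, (fun j => (j == k)%:R); split=> //.
rewrite add0r (bigD1 (Ordinal km)) //= eqxx mul1r big1 ?addr0 // => j.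
by rewrite -val_eqE /= => /negbTE ->; rewrite mul0r.
Qed.

(** * Primes disjoint from a multiplicative set *)

Lemma prime_avoiding I (W : A -> Prop) : ideal I -> W 1 ->
  (forall s t, W s -> W t -> W (s * t)) -> (forall z, I z -> ~ W z) ->
  exists Q, [/\ prime Q, forall z, I z -> Q z & forall z, Q z -> ~ W z].
Proof.
move=> Ii W1 WM IW.
pose ok X := [/\ ideal X, forall z, I z -> X z & forall z, X z -> ~ W z].
have [|Q [Qok Qmax]] := @Zorn_bigcup A (fun X => X = classical_sets.set0 \/ ok X).
  move=> F FP Ftot.
  have FX X z : F X -> X z -> ok X.
    by move=> FX Xz; have [X0|//] := FP _ FX; rewrite X0 in Xz.
  have [[z [X FX0 Xz]]|nF] := pselect (exists z, (\bigcup_(X in F) X)%classic z); last first.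
    by left; apply/seteqP; split=> z // Fz; case: nF; exists z.
  have [[_ [X0 _]] IX _] := FX _ _ FX0 Xz.
  right; split.
  - split=> //; split; first by exists X.
    split; last split.
    + move=> u v [Y FY Yu] [Z FZ Zv]; have [YZ|ZY] := Ftot _ _ FY FZ.
        by exists Z => //; have [[_ [_ [ZD _]]] _ _] := FX _ _ FZ Zv; apply: ZD => //; apply: YZ.
      by exists Y => //; have [[_ [_ [YD _]]] _ _] := FX _ _ FY Yu; apply: YD => //; apply: ZY.
    + move=> u [Y FY Yu]; exists Y => //.
      by have [[_ [_ [_ [YN _]]]] _ _] := FX _ _ FY Yu; apply: YN.
    + move=> s u _ [Y FY Yu]; exists Y => //.
      by have [Yi _ _] := FX _ _ FY Yu; apply: idealM.
  - by move=> u Iu; exists X => //; apply: IX.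
  - by move=> u [Y FY Yu]; have [_ _] := FX _ _ FY Yu; apply.
case: Qok => [Q0|[Qi IQ QW]].
  exfalso; apply: (Qmax I); last by right; split.
  by rewrite Q0; split=> // H; have [_ [/H]] := Ii.
(* By maximality, the ideal generated by [Q] and an outside element meets [W]. Multiplying two such
   elements of [W] gives primality. *)
have notQ a : ~ Q a -> exists q r, Q q /\ W (q + r * a).
  move=> Qa; apply: contrapT => nW.
  apply: (Qmax (gen Q 1 (fun=> a))).
    split; first by move=> z; apply: gen_base.
    by move=> /(_ a) H; apply: Qa; apply: H; apply: (@gen_mem Q 1 (fun=> a) 0%N).
  right; split; first exact: gen_ideal.
    by move=> z /IQ; apply: gen_base.
  move=> _ [q [c [Qq ->]]]; rewrite big_ord1 => Wz.
  by apply: nW; exists q, (c 0%N).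
have [_ [_ [QD _]]] := Qi.
exists Q; split=> //; split=> //; split; first by move=> /QW.
move=> a b _ _ Qab; apply: contrapT => /not_orP[/notQ[q [r [Qq Wq]]] /notQ[q' [r' [Qq' Wq']]]].
apply: (QW _ _ (WM _ _ Wq Wq')); rewrite mulrDl; apply: (QD).
  by rewrite mulrC; apply: idealM.
rewrite mulrDr; apply: (QD); first exact: idealM.
by rewrite mulrACA; apply: idealM.
Qed.

(** Otherwise a prime over [I] avoids all [s * b ^+ N] with [s] outside [P]. It lies in [P] (case
    [N = 0]) and misses [b] (case [s = 1], [N = 1]). *)
Lemma local_radical I P b : ideal I -> prime P ->
  (forall Q, prime Q -> (forall z, I z -> Q z) -> (forall z, Q z -> P z) -> Q b) ->
  exists s N, ~ P s /\ I (s * b ^+ N).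
Proof.
move=> Ii [Pi [P1 PM]] Hb; apply: contrapT => nI.
have [|||Q [Qp IQ QW]] := @prime_avoiding I (fun z => exists s N, ~ P s /\ z = s * b ^+ N) Ii.
- by exists 1, 0%N; rewrite expr0 mulr1.
- move=> _ _ [s [N [Ps ->]]] [t [N' [Pt ->]]]; exists (s * t), (N + N')%N.
  by rewrite exprD mulrACA; split=> // /PM[].
- by move=> z Iz [s [N [Ps e]]]; apply: nI; exists s, N; rewrite -e.
have QP z : Q z -> P z.
  by move=> Qz; apply: contrapT => Pz; apply: (QW z Qz); exists z, 0%N; rewrite expr0 mulr1.
by apply: (QW b (Hb Q Qp IQ QP)); exists 1, 1%N; rewrite mul1r expr1.
Qed.

(** For [I] inside [P], this says that the localization of [A/I] at [P] has dimension at least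
    [n]. *)
Definition chain_above I P (n : nat) : Prop :=
  exists C : nat -> A -> Prop,
    [/\ forall k, (k <= n)%N -> prime (C k),
        forall k, (k < n)%N -> strict_incl (C k) (C k.+1),
        C n = P & forall z, I z -> C 0%N z].

(* Krull's boundary ideal of [x], relative to [I] and localized at [P]: no prime
   containing it is minimal over [I], so it cuts the length of chains by one. *)
Definition boundary I P (x : A) (z : A) : Prop :=
  exists r u, z = r * x + u /\
    forall Q, prime Q -> (forall z, I z -> Q z) -> (forall z, Q z -> P z) -> Q (u * x).

Lemma boundary_ideal I P x : ideal (boundary I P x).
Proof.
split=> //; split; last split; last split.
- by exists 0, 0; rewrite mul0r addr0; split=> // Q [[_ [Q0 _]] _] _ _.
- move=> _ _ [r [u [-> Hu]]] [r' [u' [-> Hu']]]; exists (r + r'), (u + u').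
  split=> [|Q Qp IQ QP]; first by rewrite mulrDl addrACA.
  by rewrite mulrDl; have [[_ [_ [QD _]]] _] := Qp; apply: (QD); [exact: Hu|exact: Hu'].
- move=> _ [r [u [-> Hu]]]; exists (- r), (- u); split=> [|Q Qp IQ QP].
    by rewrite mulNr opprD.
  by rewrite mulNr; have [[_ [_ [_ [QN _]]]] _] := Qp; apply: QN; exact: Hu.
- move=> s _ _ [r [u [-> Hu]]]; exists (s * r), (s * u); split=> [|Q Qp IQ QP].
    by rewrite mulrDr mulrA.
  by rewrite -mulrA; apply: idealM; [case: Qp|exact: Hu].
Qed.

(** The bottom prime [C 0] contains [x]. Were it minimal over [I], some [s * x ^+ N] with [s]
    outside [C 0] would lie in [I], which puts [s] in the boundary ideal and so in [C 0]. Hence a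
    smaller prime extends the chain. *)
Lemma chain_boundary I P x n : ideal I ->
  chain_above (boundary I P x) P n -> chain_above I P n.+1.
Proof.
move=> Ii [C [Cp Cs CP IC]]; have C0p := Cp _ (leq0n n).
have C0x : C 0%N x.
  apply: IC; exists 1, 0; rewrite mul1r addr0; split=> // Q [[_ [Q0 _]] _] _ _.
  by rewrite mul0r.
have [[Q [Qp IQ QC]]|nQ] :=
    pselect (exists Q, [/\ prime Q, forall z, I z -> Q z & strict_incl Q (C 0%N)]).
  exists (fun k => if k is k'.+1 then C k' else Q); split=> //.
  - by case=> // k; rewrite ltnS => /Cp.
  - by case=> // k; rewrite ltnS => /Cs.
have [|s [N [C0s Is]]] := @local_radical I (C 0%N) x Ii C0p.
  move=> Q Qp IQ QC; apply: contrapT => Qx; apply: nQ; exists Q; split=> //.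
  by split=> //; exists x.
exfalso; apply: C0s; apply: IC; exists 0, s; rewrite mul0r add0r; split=> // Q Qp IQ _.
have [Qi _] := Qp; have [Qs|Qx] := prime_exp Qp (IQ _ Is); last exact: idealM.
by rewrite mulrC; apply: idealM.
Qed.

(* Local Kronecker theorem: if [P] has height at most [d], then up to radical in the
   localization at [P] a further generator [b] is absorbed by [d] generators. *)
Lemma absorb_generator P d I b (x : nat -> A) : prime P -> ideal I ->
  ~ chain_above I P d.+1 -> P b ->
  exists a : nat -> A, forall Q, prime Q -> (forall z, I z -> Q z) -> (forall z, Q z -> P z) ->
    (forall k, (k < d)%N -> Q (x k + b * a k)) -> Q b.
Proof.
move=> Pp Ii nC Pb; elim: d I Ii nC => [|d IHd] I Ii nC.
  (* For [d = 0], a prime [Q] missing [b] would be strictly below [P] and give a chain of length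
     one. *)
  exists (fun=> 0) => Q Qp IQ QP _; apply: contrapT => Qb; apply: nC.
  exists (fun k => if k is 0%N then Q else P); split=> //; first by case.
  by case=> // _; split=> //; exists b.
(* Passing to the boundary of the last generator lowers the dimension, so induction provides the
   first [d] coefficients. *)
pose I' := boundary I P (x d).
have I'i : ideal I' by apply: boundary_ideal.
have [|a Ha] := IHd I' I'i; first by move/(chain_boundary Ii).
pose y k := x k + b * a k.
have [|s [N [Ps]]] := @local_radical (gen I' d y) P b (gen_ideal _ _ I'i) Pp.
  move=> Q Qp IQ QP; apply: Ha => // [z Iz|k kd]; apply: IQ; first exact: gen_base.
  exact: gen_mem.
move=> [_ [c [[r [u [-> Hu]]] eb]]].
(* The last coefficient is the part [u] of the relation [s b^N = r x_d + u + sum c_k y_k]. If [Q]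
   misses [b], then [u x_d] and [x_d + b u] in [Q] force both [u] and [x_d] into [Q], hence also
   [s b^N]. *)
exists (fun k => if (k < d)%N then a k else u) => Q Qp IQ QP Qy.
have [[_ [_ [QD [QN _]]]] [_ QM]] := Qp; have Qi := Qp.1.
have Qyk k : (k < d)%N -> Q (y k).
  by move=> kd; have := Qy k (ltnW kd); rewrite kd.
have Qxu : Q (x d + b * u) by have := Qy d (ltnSn d); rewrite ltnn.
apply: contrapT => Qb.
have [Qx Qu] : Q (x d) /\ Q u.
  have [Qu|Qx] := QM u (x d) Logic.I Logic.I (Hu Q Qp IQ QP).
    split=> //; have -> : x d = (x d + b * u) + - (b * u) by rewrite addrK.
    by apply: (QD) => //; apply: QN; apply: idealM.
  split=> //; have : Q (b * u).
    have -> : b * u = (x d + b * u) + - x d by rewrite addrC addKr.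
    by apply: (QD) => //; apply: QN.
  by move/(QM _ _ Logic.I Logic.I) => [].
have : Q (s * b ^+ N).
  rewrite eb; apply: (QD); first by apply: (QD) => //; apply: idealM.
  by apply: ideal_sum => // k; apply: idealM => //; apply: Qyk.
by move=> /(prime_exp Qp)[/QP|].
Qed.

(** The [x k] are absorbed one by one, over the zero ideal. A prime containing the modified [y]
    contains the new [x l], hence the old [y], hence the earlier [x k]. *)
Lemma local_generators P d l (x : nat -> A) : prime P ->
  ~ dim_loc_ge (fun _ : A => True) P d.+1 -> (forall k, P (x k)) ->
  exists y : nat -> A, (forall k, (k < d)%N -> P (y k)) /\
    forall Q, prime Q -> (forall z, Q z -> P z) -> (forall k, (k < d)%N -> Q (y k)) ->
    forall k, (k < l)%N -> Q (x k).
Proof.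
move=> Pp nC Px; have [Pi _] := Pp; have [_ [P0 [PD _]]] := Pi.
elim: l => [|l [y [Py IHl]]]; first by exists (fun=> 0).
have [|a Ha] := @absorb_generator P d (eq^~ 0) (x l) y Pp zero_ideal _ (Px l).
  by move=> [C [Cp Cs CP _]]; apply: nC; exists C.
exists (fun k => y k + x l * a k); split=> [k kd|Q Qp QP Qy k].
  by apply: (PD); [exact: Py|rewrite mulrC; apply: idealM].
have [Qi _] := Qp; have [_ [Q0 [QD [QN _]]]] := Qi.
have Qx : Q (x l) by apply: Ha => // z ->.
rewrite ltnS leq_eqVlt => /orP[/eqP -> //|]; apply: IHl => // j jd.
have -> : y j = (y j + x l * a j) + - (x l * a j) by rewrite addrK.
by apply: (QD); [exact: Qy|apply: QN; rewrite mulrC; exact: idealM].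
Qed.

Lemma mul_module (S M : A -> Prop) : M 0 -> (forall u v, M u -> M v -> M (u + v)) ->
  (forall v, M v -> M (- v)) -> (forall r v, S r -> M v -> M (r * v)) ->
  is_module S (@GRing.mul A) M.
Proof.
move=> M0 MD MN MZ; split=> //.
- exact: mulrDr.
- exact: mulrDl.
- exact: mulrA.
- exact: mul1r.
Qed.

(* If the height of [P] were less than [n = d + 1], then [x] could be replaced by [d]
   elements [y] of [P], and [H^d(y) = A / (y)] is nonzero at [P]. *)
Theorem Kgrade_le_height P n l (x : 'I_l -> A) : prime P -> (forall k, P (x k)) ->
  Kgrade_fg_ge (@GRing.mul A) (fun _ : A => True) x n ->
  dim_loc_ge (fun _ : A => True) P n.
Proof.
have Mm : is_module (fun _ : A => True) (@GRing.mul A) (fun _ : A => True) by exact: mul_module.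
move=> Pp Px /(Kgrade_fg_geE Mm) Hx; have [[_ [P0 [PD [PN _]]]] [P1 PM]] := Pp.
case: n Hx => [|d] Hx; first by exists (fun=> P); split=> //; split.
apply: contrapT => nC.
pose x' k := if insub k is Some i then x i else 0.
have Px' k : P (x' k) by rewrite /x'; case: insub.
have x'E (i : 'I_l) : x i = x' i by rewrite /x' valK.
have [y [Py Hy]] := local_generators l Pp nC Px'.
pose W z := ~ P z.
have WM s t : W s -> W t -> W (s * t) by move=> Ws Wt /PM[].
(* Localized at [P], each [x k] is in the radical of the ideal of [y], so the bound passes to
   [y]. *)
have Ky : kgr (@GRing.mul A) (fun _ : A => True) W d.+1 (fun i : 'I_d => y i).
  apply: (@kgr_radical A (fun=> True) _ _ _ Mm _ W _ P1 WM d.+1 l d x') => //.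
    move=> k kl.
    have Gi := gen_ideal d y zero_ideal.
    have [|s [N [Ps [_ [a [-> sa]]]]]] := @local_radical _ P (x' k) Gi Pp.
      by move=> Q Qp IQ QP; apply: Hy => // j jd; apply: IQ; apply: gen_mem zero_ideal jd.
    by exists s, N, a; rewrite sa add0r.
  move=> i lt_id c Mc dc; have [|s [<- bc]] := Hx i lt_id c Mc.
    by move=> T; rewrite -(dc T); apply: eq_kdx => k; rewrite x'E.
  exists 1; split=> //; move: bc => [b [Mb cb]]; exists b; split=> // T.
  by rewrite cb; apply: eq_kdx => k; rewrite x'E.
(* The class of [1] in the top degree [d]. If [s] kills it, then [s] is a combination of the [y j],
   hence in [P], against [W s]. *)
pose c (T : {set 'I_d}) : A := (T == [set: 'I_d])%:R.
have [|T|s [Ws [b [_ cb]]]] := Ky d (ltnSn d) c.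
- move=> T; rewrite addn0; case: eqP => // Td; rewrite /c; case: eqP => // TT.
  by case: Td; rewrite TT cardsT card_ord.
- rewrite kdE big1 // => j jT; rewrite /c; case: eqP => [e|_]; last by rewrite mulr0 sg0.
  by have := setD11 j T; rewrite e in_setT.
apply: Ws; have := cb setT; rewrite /c eqxx mulr1 => ->; rewrite kdE.
elim/big_rec: _ => // j z _ Pz; apply: (PD) => //.
have Pt : P (y j * b (setT :\ j)) by rewrite mulrC; apply: idealM; [case: Pp|exact: Py].
by case: odd => //; apply: PN.
Qed.

End Primes.

(** * The bowtie ring *)

Section Bowtie.
Variables (A B : comNzRingType) (f : {rmorphism A -> B}) (J : B -> Prop).
Hypothesis (hJ : is_ideal (fun _ : B => True) J).
Hypothesis (hJnil : forall j, J j -> exists n : nat, j ^+ n = 0).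
Notation S := (bowtie f J).
Notation whole := (fun _ : A => True).
Notation actJ := (fun (r : A) (v : B) => f r * v).

Let J0 : J 0. Proof. by case: hJ => _ []. Qed.
Let JD u v : J u -> J v -> J (u + v). Proof. by case: hJ => _ [_ [H _]]; apply: H. Qed.
Let JN u : J u -> J (- u). Proof. by case: hJ => _ [_ [_ [H _]]]; apply: H. Qed.
Let JM r u : J u -> J (r * u). Proof. exact: idealM. Qed.

Lemma bowtieE z : S z <-> J (z.2 - f z.1).
Proof.
split=> [[a [j [Jj ->]]]|Jz]; first by rewrite /= addrC addKr.
by exists z.1, (z.2 - f z.1); split=> //; rewrite addrC subrK; case: z {Jz}.
Qed.

Lemma bowtie_embed a : S (a, f a).
Proof. by apply/bowtieE; rewrite subrr. Qed.

Lemma bowtie_nil j : J j -> S (0, j).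
Proof. by move=> Jj; apply/bowtieE; rewrite /= rmorph0 subr0. Qed.

Lemma bowtieD z w : S z -> S w -> S (z + w).
Proof.
move=> /bowtieE Jz /bowtieE Jw; apply/bowtieE.
by rewrite /= rmorphD opprD addrACA; apply: JD.
Qed.

Lemma bowtieN z : S z -> S (- z).
Proof. by move=> /bowtieE Jz; apply/bowtieE; rewrite /= rmorphN -opprD; apply: JN. Qed.

Lemma bowtieM z w : S z -> S w -> S (z * w).
Proof.
move=> /bowtieE Jz /bowtieE Jw; apply/bowtieE; rewrite /= rmorphM.
have -> : z.2 * w.2 - f z.1 * f w.1 = w.2 * (z.2 - f z.1) + f z.1 * (w.2 - f w.1).
  by rewrite !mulrBr addrA [w.2 * f _]mulrC subrK mulrC.
by apply: JD; apply: JM.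
Qed.

Lemma bowtie0 : S 0.
Proof. by have := bowtie_embed 0; rewrite rmorph0. Qed.

Lemma bowtie_subring : is_subring S.
Proof.
split; [exact: bowtie0| |exact: bowtieD|exact: bowtieM].
by have := bowtie_embed 1; rewrite rmorph1.
Qed.

Lemma bowtie_module : is_module S (@GRing.mul (A * B)%type) S.
Proof.
apply: mul_module; [exact: bowtie0|exact: bowtieD|exact: bowtieN|exact: bowtieM].
Qed.

Lemma whole_module : is_module whole (@GRing.mul A) whole.
Proof. exact: mul_module. Qed.

Lemma ideal_module : is_module whole actJ J.
Proof.
split=> //.
- by move=> r u v; rewrite mulrDr.
- by move=> r s v; rewrite rmorphD mulrDl.
- by move=> r s v; rewrite rmorphM mulrA.
- by move=> v; rewrite rmorph1 mul1r.
- by move=> r v _; apply: JM.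
Qed.

(** * Primes and heights along the projection to [A] *)

Definition up (p : A -> Prop) (z : A * B) : Prop := p z.1 /\ S z.
Definition proj (I : A * B -> Prop) (a : A) : Prop := exists z, I z /\ z.1 = a.

Lemma nilpotent_embed j : J j -> exists N, (0, j) ^+ N = 0 :> A * B.
Proof.
(* A successor exponent exposes a factor [0] in the first component. *)
move=> /hJnil[n jn]; exists n.+1.
have X2 m : ((0, j) ^+ m : A * B).2 = j ^+ m.
  by elim: m => // m IHm; rewrite !exprS /= IHm.
rewrite exprS; apply: injective_projections => /=; first by rewrite mul0r.
by rewrite X2 jn mulr0.
Qed.

Lemma up_ideal p : is_ideal whole p -> is_ideal S (up p).
Proof.
move=> [_ [p0 [pD [pN pM]]]]; split; first by move=> z [].
split; first by split=> //; exact: bowtie0.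
split; last split.
- by move=> z w [pz Sz] [pw Sw]; split; [exact: pD|exact: bowtieD].
- by move=> z [pz Sz]; split; [exact: pN|exact: bowtieN].
- by move=> s z Ss [pz Sz]; split; [exact: pM|exact: bowtieM].
Qed.

Lemma proj_ideal I : is_ideal S I -> is_ideal whole (proj I).
Proof.
move=> [IS [I0 [ID [IN IM]]]]; split=> //; split; first by exists 0.
split; last split.
- by move=> _ _ [z [Iz <-]] [w [Iw <-]]; exists (z + w); split=> //; exact: ID.
- by move=> _ [z [Iz <-]]; exists (- z); split=> //; exact: IN.
- move=> s _ _ [z [Iz <-]]; exists ((s, f s) * z); split=> //.
  by apply: IM => //; apply: bowtie_embed.
Qed.

Lemma up_prime p : is_prime whole p -> is_prime S (up p).
Proof.
move=> [pi [p1 pM]]; split; first exact: up_ideal.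
split=> [[]//|z w Sz Sw [/pM H _]].
by case: (H Logic.I Logic.I) => [pz|pw]; [left|right].
Qed.

Lemma prime_nil P j : is_prime S P -> J j -> P (0, j).
Proof.
move=> [[_ [P0 _]] [P1 PM]] Jj; have [n jn] := nilpotent_embed Jj.
have Sj := bowtie_nil Jj.
have : P ((0, j) ^+ n) by rewrite jn.
elim: n {jn} => [/P1 //|m IHm]; rewrite exprS => /PM[] //.
exact: subringX bowtie_subring Sj.
Qed.

(** Two elements with the same first component differ by some [(0, j)] with [j] in [J], which is
    nilpotent and so lies in [P]. *)
Lemma up_proj P : is_prime S P -> up (proj P) = P.
Proof.
move=> Pp; have [[PS [_ [PD _]]] _] := Pp.
apply/funext => z; apply/propext; split=> [[[w [Pw wz]] Sz]|Pz]; last first.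
  by split; [exists z|exact: PS].
have -> : z = w + (0, (z.2 - f z.1) - (w.2 - f w.1)).
  apply: injective_projections => /=; first by rewrite wz addr0.
  by rewrite wz; ring.
apply: PD => //; apply: prime_nil => //; apply: JD; first exact/bowtieE.
by apply: JN; apply/bowtieE; apply: PS.
Qed.

Lemma proj_up p : proj (up p) = p.
Proof.
apply/funext => a; apply/propext; split=> [[z [[pz _] <-]] //|pa].
by exists (a, f a); split=> //; split=> //; apply: bowtie_embed.
Qed.

Lemma proj_prime P : is_prime S P -> is_prime whole (proj P).
Proof.
move=> Pp; have [Pi [P1 PM]] := Pp; have eP := up_proj Pp.
(* Membership is tested on the multiplicative section [a |-> (a, f a)], which reduces primality to
   that of [P]. *)
have inP a : proj P a <-> P (a, f a).
  split=> [Pa|Pa]; last by exists (a, f a).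
  by rewrite -eP; split=> //; apply: bowtie_embed.
split; first exact: proj_ideal.
split=> [/inP|a b _ _ /inP]; first by rewrite rmorph1.
rewrite rmorphM => /(PM _ _ (bowtie_embed a) (bowtie_embed b)).
by case=> /inP; [left|right].
Qed.

Lemma dim_loc_up p n : dim_loc_ge S (up p) n <-> dim_loc_ge whole p n.
Proof.
split=> [[D [Dp [Ds Dn]]]|[C [Cp [Cs Cn]]]].
  exists (fun k => proj (D k)); split; first by move=> k /Dp; apply: proj_prime.
  split; last by rewrite Dn proj_up.
  move=> k kn; have [DD [z [Dz nDz]]] := Ds k kn; split.
    by move=> _ [w [Dw <-]]; exists w; split=> //; apply: DD.
  exists z.1; split; first by exists z.
  move=> Pz; apply: nDz; rewrite -(up_proj (Dp k (ltnW kn))); split=> //.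
  by have [[DS _] _] := Dp k.+1 kn; apply: DS.
exists (fun k => up (C k)); split; first by move=> k /Cp; apply: up_prime.
split; last by rewrite Cn.
move=> k kn; have [CC [a [Ca nCa]]] := Cs k kn; split.
  by move=> z [Cz Sz]; split=> //; apply: CC.
by exists (a, f a); split=> [|[]//]; split=> //; apply: bowtie_embed.
Qed.

Lemma ht_proj I n : (forall z, I z -> S z) -> ht_ge S I n <-> ht_ge whole (proj I) n.
Proof.
move=> IS; split=> H P Pp IP.
  apply/dim_loc_up; apply: H; first exact: up_prime.
  by move=> z Iz; split; [apply: IP; exists z|exact: IS].
rewrite -(up_proj Pp); apply/dim_loc_up; apply: H; first exact: proj_prime.
by move=> _ [z [Iz <-]]; exists z; split=> //; apply: IP.
Qed.

(* As an [A]-module the bowtie ring is [A (+) J], via [(a, f a + j) |-> (a, j)]. *)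
Lemma kgr_bowtie n l (x : 'I_l -> A) :
  kgr (@GRing.mul (A * B)%type) S (eq 1) n (fun k => (x k, f (x k))) <->
  kgr (@GRing.mul A) whole (eq 1) n x /\ kgr actJ J (eq 1) n x.
Proof.
pose X k : A * B := (x k, f (x k)).
pose pJ (z : A * B) : B := z.2 - f z.1.
pose iA (a : A) : A * B := (a, f a).
pose iJ (b : B) : A * B := (0, b).
have pAP : koszul_map (@GRing.mul (A * B)%type) (@GRing.mul A) S whole X x fst by split.
have pJP : koszul_map (@GRing.mul (A * B)%type) actJ S J X x pJ.
  split=> [u v|k v|v]; last by move/bowtieE.
    by rewrite /pJ /= rmorphD opprD addrACA.
  by rewrite /pJ /= rmorphM mulrBr.
have iAP : koszul_map (@GRing.mul A) (@GRing.mul (A * B)%type) whole S x X iA.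
  split=> [u v|k v|v _]; last exact: bowtie_embed.
    by rewrite /iA rmorphD.
  by rewrite /iA rmorphM.
have iJP : koszul_map actJ (@GRing.mul (A * B)%type) J S x X iJ.
  split=> [u v|k v|v]; last exact: bowtie_nil.
    by apply: injective_projections; rewrite /= ?addr0.
  by apply: injective_projections; rewrite /= ?mulr0.
have one1 := act1 bowtie_module; have one2 := act1 whole_module; have one3 := act1 ideal_module.
split=> [H|[HA HJ]].
  split; first exact: (kgr_summand one1 one2 pAP iAP).
  by apply: (kgr_summand one1 one3 pJP iJP) => // v; rewrite /pJ /= rmorph0 subr0.
apply: (kgr_direct_sum bowtie_module one2 one3 pAP pJP iAP iJP) => // v.
by apply: injective_projections; rewrite /= ?addr0 // addrC subrK.
Qed.

(** Here [z = e + w] with [e] nilpotent, and [z ^+ N] is congruent to [e ^+ N] modulo [w]. *)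
Lemma bowtie_radical z w : S z -> S w -> z.1 = w.1 ->
  exists N a, S a /\ z ^+ N = a * w.
Proof.
move=> Sz Sw zw; have Jj : J (z.2 - w.2).
  have -> : z.2 - w.2 = (z.2 - f z.1) + - (w.2 - f w.1) by rewrite zw opprB addrA subrK.
  by apply: JD; [|apply: JN]; apply/bowtieE.
have [N eN] := nilpotent_embed Jj; pose e : A * B := (0, z.2 - w.2).
have Se : S e by apply: bowtie_nil.
have SX m : S (e ^+ m) by apply: subringX bowtie_subring Se.
have ez : z = e + w.
  by apply: injective_projections; rewrite /= ?add0r // subrK.
have E m : exists a, S a /\ z ^+ m = e ^+ m + a * w.
  elim: m => [|m [a [Sa IHm]]]; first by exists 0; rewrite mul0r addr0; split=> //; exact: bowtie0.
  exists (e ^+ m + z * a); split; first by apply: bowtieD => //; apply: bowtieM.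
  rewrite !exprS {1}IHm mulrDr mulrA {1}ez !mulrDl addrA; congr (_ + _ + _).
  by rewrite mulrC.
have [a [Sa Ea]] := E N; exists N, a; split=> //.
by rewrite Ea /e eN add0r.
Qed.

(** Some power of each [x k] is a multiple of [y k], so [kgr_radical] applies without localizing. *)
Lemma kgr_same_proj n l (x y : 'I_l -> A * B) :
  (forall k, S (x k)) -> (forall k, S (y k)) -> (forall k, (x k).1 = (y k).1) ->
  kgr (@GRing.mul (A * B)%type) S (eq 1) n x -> kgr (@GRing.mul (A * B)%type) S (eq 1) n y.
Proof.
move=> Sx Sy xy H.
pose ext (u : 'I_l -> A * B) k := if insub k is Some i then u i else 0.
have Sext u : (forall k, S (u k)) -> forall k, S (ext u k).
  by move=> Su k; rewrite /ext; case: insub => // ; exact: bowtie0.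
have extE u (i : 'I_l) : ext u i = u i by rewrite /ext valK.
have W1 s : 1 = s -> S s by move=> <-; exact: subring1 bowtie_subring.
have WM s t : 1 = s -> 1 = t -> 1 = s * t :> A * B by move=> <- <-; rewrite mulr1.
apply: (eq_kgr (extE y)).
apply: (@kgr_radical _ _ _ _ _ bowtie_module bowtie_subring _ W1 erefl WM n l l (ext x)).
- exact: Sext.
- exact: Sext.
- move=> k kl; have [N [a [Sa Ea]]] := bowtie_radical (Sx (Ordinal kl)) (Sy (Ordinal kl)) (xy _).
  exists 1, N, (fun j => if j == k then a else 0); split=> //.
    by move=> j; case: eqP => // _; exact: bowtie0.
  rewrite (bigD1 (Ordinal kl)) //= eqxx big1 ?addr0 => [|j].
    by rewrite mul1r -[k]/(val (Ordinal kl)) !extE.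
  by rewrite -val_eqE /= => /negbTE ->; rewrite mul0r.
- by apply: eq_kgr H => k; rewrite extE.
Qed.

Lemma Kgrade_proj I n : is_ideal S I ->
  Kgrade_ge (@GRing.mul (A * B)%type) S I n <->
  Kgrade_ge (@GRing.mul A) whole (proj I) n /\ Kgrade_ge actJ J (proj I) n.
Proof.
move=> Ii; have [IS _] := Ii; split=> [[l [x [Ix /(Kgrade_fg_geE bowtie_module) Hx]]]|].
  have [|HA HJ] := (kgr_bowtie n (fun k => (x k).1)).1.
    apply: kgr_same_proj Hx => // k; [exact: IS|exact: bowtie_embed].
  by split; exists l, (fun k => (x k).1); split;
    [move=> k; exists (x k)|exact/(Kgrade_fg_geE whole_module)
    |move=> k; exists (x k)|exact/(Kgrade_fg_geE ideal_module)].
move=> [[l [x [Ix /(Kgrade_fg_geE whole_module) Hx]]]].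
move=> [l' [x' [Ix' /(Kgrade_fg_geE ideal_module) Hx']]].
pose ext m (u : 'I_m -> A) k := if insub k is Some i then u i else 0.
(* The grades of [A] and of [J] may be witnessed by different sequences; their concatenation serves
   both. *)
pose z k := if (k < l)%N then ext _ x k else ext _ x' (k - l)%N.
have Iext m (u : 'I_m -> A) k : (forall k, proj I (u k)) -> proj I (ext m u k).
  by move=> Iu; rewrite /ext; case: insub => //; exists 0; case: Ii => _ [].
have Iz k : proj I (z k) by rewrite /z; case: ifP => _; apply: Iext.
have zx (i : 'I_l) : x i = z i by rewrite /z ltn_ord /ext valK.
have zx' (i : 'I_l') : x' i = z (l + i)%N by rewrite /z ltnNge leq_addr addKn /ext valK.
have one s t : 1 = s -> 1 = t -> 1 = s * t :> A by move=> <- <-; rewrite mulr1.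
have HA := kgr_append (l := l') whole_module (fun=> fun=> Logic.I) erefl one
  (fun=> Logic.I) (eq_kgr zx Hx).
have HJ := kgr_prepend ideal_module (fun=> fun=> Logic.I) erefl one
  (fun=> Logic.I) (eq_kgr zx' Hx').
(* The pairs [(z k, f (z k))] need not lie in [I], so lifts of the [z k] to [I] are chosen and
   compared with them by [kgr_same_proj]. *)
have [w Iw] := choice Iz.
exists (l + l')%N, (fun k => w k); split; first by move=> k; case: (Iw k).
apply/(Kgrade_fg_geE bowtie_module).
apply: kgr_same_proj ((kgr_bowtie n _).2 (conj HA HJ)) => k; first exact: bowtie_embed.
  by apply: IS; case: (Iw k).
by case: (Iw k).
Qed.

End Bowtie.

(** * Transfer of the Cohen-Macaulay property *)

Theorem theorem4p6 (A B : comNzRingType) (f : {rmorphism A -> B}) (J : B -> Prop)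
  (hJ : is_ideal (fun _ : B => True) J)
  (hJnil : forall j, J j -> exists n : nat, j ^+ n = 0) :
  CM_ideals (bowtie f J) <->
  (CM_ideals (fun _ : A => True) /\
   forall a : A -> Prop, is_ideal (fun _ : A => True) a ->
     forall n : nat, ht_ge (fun _ : A => True) a n ->
       Kgrade_ge (fun (r : A) (v : B) => f r * v) J a n).
Proof.
(* One inequality holds over every ring, so only lower bounds on grades remain at stake. *)
have grade_ht a n : Kgrade_ge (@GRing.mul A) (fun=> True) a n -> ht_ge (fun=> True) a n.
  move=> [l [x [ax Hx]]] P Pp aP.
  by apply: Kgrade_le_height Hx => // k; apply: aP.
split=> [CM|[CM HJ] I Ii n]; last first.
  have IS : forall z, I z -> bowtie f J z by case: Ii.
  have pIi := proj_ideal hJ Ii.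
  rewrite (ht_proj hJ hJnil _ IS) (Kgrade_proj hJ hJnil n Ii).
  split=> [ht|[/grade_ht //]]; split; [exact/CM|exact: HJ].
(* The hypothesis is applied to the preimage [up f J a], whose projection is [a] again. *)
have key a n : is_ideal (fun=> True) a -> ht_ge (fun=> True) a n ->
    Kgrade_ge (@GRing.mul A) (fun=> True) a n /\
    Kgrade_ge (fun (r : A) (v : B) => f r * v) J a n.
  move=> ai; have ui := up_ideal f hJ ai.
  have US : forall z, up f J a z -> bowtie f J z by move=> z [].
  have := CM _ ui n; rewrite (ht_proj hJ hJnil _ US) (Kgrade_proj hJ hJnil n ui).
  by rewrite proj_up // => -[].
split=> [a ai n|a ai n /(key a n ai)[]//].
by split=> [/(key a n ai)[]|/grade_ht].
Qed.
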